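(* Let $D$ be a dendriform algebra, $V$ a vector space, and $\Omega(D,V)=(\triangleright_1,\triangleright_2,\triangleleft_1,\triangleleft_2,\rightharpoonup_1,\rightharpoonup_2,\leftharpoonup_1,\leftharpoonup_2,f_1,f_2,\succ_V,\prec_V)$ an extending datum of $D$ through $V$. Then the following statements are equivalent. (1) $D\natural V$ is a unified product, i.e. $(D\times V,\succeq,\preceq)$ is a dendriform algebra. (2) The following conditions hold for all $a,b\in D$ and $x,y,z\in V$: (D1) $(V,\triangleright_1,\triangleright_2,\triangleleft_1,\triangleleft_2)$ is a $D$ bimodule. (D2) $(a\star b)\leftharpoonup_1 x=a\succ(b\leftharpoonup_1 x)+a\leftharpoonup_1(b\triangleright_1 x)$; $(a\prec b)\leftharpoonup_2 x=a\prec(b\leftharpoonup x)+a\leftharpoonup_2(b\triangleright x)$; $(a\succ b)\leftharpoonup_2 x=a\succ(b\leftharpoonup_2 x)+a\leftharpoonup_1(b\triangleright_2 x)$. (D3) $(x\rightharpoonup a)\succ b+(x\triangleleft a)\rightharpoonup_1 b=x\rightharpoonup_1(a\succ b)$; $(x\rightharpoonup_2 a)\prec b+(x\triangleleft_2 a)\rightharpoonup_2 b=x\rightharpoonup_2(a\star b)$; $(x\rightharpoonup_1 a)\prec b+(x\triangleleft_1 a)\rightharpoonup_2 b=x\rightharpoonup_1(a\prec b)$. (D4) $(a\leftharpoonup x)\succ b+(a\triangleright x)\rightharpoonup_1 b=a\succ(x\rightharpoonup_1 b)+a\leftharpoonup_1(x\triangleleft_1 b)$; $(a\leftharpoonup_2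 x)\prec b+(a\triangleright_2 x)\rightharpoonup_2 b=a\prec(x\rightharpoonup b)+a\leftharpoonup_2(x\triangleleft b)$; $(a\leftharpoonup_1 x)\prec b+(a\triangleright_1 x)\rightharpoonup_2 b=a\succ(x\rightharpoonup_2 b)+a\leftharpoonup_1(x\triangleleft_2 b)$. (D5) $f(x,y)\succ a+(x\star_V y)\rightharpoonup_1 a=x\rightharpoonup_1(y\rightharpoonup_1 a)+f_1(x,y\triangleleft_1 a)$; $f_2(x,y)\prec a+(x\prec_V y)\rightharpoonup_2 a=x\rightharpoonup_2(y\rightharpoonup a)+f_2(x,y\triangleleft a)$; $f_1(x,y)\prec a+(x\succ_V y)\rightharpoonup_2 a=x\rightharpoonup_1(y\rightharpoonup_2 a)+f_1(x,y\triangleleft_2 a)$. (D6) $(x\star_V y)\triangleleft_1 a=x\triangleleft_1(y\rightharpoonup_1 a)+x\succ_V(y\triangleleft_1 a)$; $(x\prec_V y)\triangleleft_2 a=x\triangleleft_2(y\rightharpoonup a)+x\prec_V(y\triangleleft a)$; $(x\succ_V y)\triangleleft_2 a=x\triangleleft_1(y\rightharpoonup_2 a)+x\succ_V(y\triangleleft_2 a)$. (D7) $(a\leftharpoonup x)\leftharpoonup_1 y+f_1(a\triangleright x,y)=a\succ f_1(x,y)+a\leftharpoonup_1(x\succ_V y)$; $(a\leftharpoonup_2 x)\leftharpoonup_2 y+f_2(a\triangleright_2 x,y)=a\prec f(x,y)+a\leftharpoonup_2(x\star_V y)$; $(a\leftharpoonup_1 x)\leftharpoonup_2 y+f_2(a\triangleright_1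 x,y)=a\succ f_2(x,y)+a\leftharpoonup_1(x\prec_V y)$. (D8) $(a\leftharpoonup x)\triangleright_1 y+(a\triangleright x)\succ_V y=a\triangleright_1(x\succ_V y)$; $(a\leftharpoonup_2 x)\triangleright_2 y+(a\triangleright_2 x)\prec_V y=a\triangleright_2(x\star_V y)$; $(a\leftharpoonup_1 x)\triangleright_2 y+(a\triangleright_1 x)\prec_V y=a\triangleright_1(x\prec_V y)$. (D9) $(x\rightharpoonup a)\leftharpoonup_1 y+f_1(x\triangleleft a,y)=x\rightharpoonup_1(a\leftharpoonup_1 y)+f_1(x,a\triangleright_1 y)$; $(x\rightharpoonup_2 a)\leftharpoonup_2 y+f_2(x\triangleleft_2 a,y)=x\rightharpoonup_2(a\leftharpoonup y)+f_2(x,a\triangleright y)$; $(x\rightharpoonup_1 a)\leftharpoonup_2 y+f_2(x\triangleleft_1 a,y)=x\rightharpoonup_1(a\leftharpoonup_2 y)+f_1(x,a\triangleright_2 y)$. (D10) $(x\rightharpoonup a)\triangleright_1 y+(x\triangleleft a)\succ_V y=x\triangleleft_1(a\leftharpoonup_1 y)+x\succ_V(a\triangleright_1 y)$; $(x\rightharpoonup_2 a)\triangleright_2 y+(x\triangleleft_2 a)\prec_V y=x\triangleleft_2(a\leftharpoonup y)+x\prec_V(a\triangleright y)$; $(x\rightharpoonup_1 a)\triangleright_2 y+(x\triangleleft_1 a)\prec_V y=x\triangleleft_1(a\leftharpoonup_2 y)+x\succ_V(a\triangleright_2 y)$. (D11) $f(x,y)\leftharpoonup_1 z+f_1(x\star_V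 y,z)=x\rightharpoonup_1 f_1(y,z)+f_1(x,y\succ_V z)$; $f_2(x,y)\leftharpoonup_2 z+f_2(x\prec_V y,z)=x\rightharpoonup_2 f(y,z)+f_2(x,y\star_V z)$; $f_1(x,y)\leftharpoonup_2 z+f_2(x\succ_V y,z)=x\rightharpoonup_1 f_2(y,z)+f_1(x,y\prec_V z)$. (D12) $f(x,y)\triangleright_1 z+(x\star_V y)\succ_V z=x\triangleleft_1 f_1(y,z)+x\succ_V(y\succ_V z)$; $f_2(x,y)\triangleright_2 z+(x\prec_V y)\prec_V z=x\triangleleft_2 f(y,z)+x\prec_V(y\star_V z)$; $f_1(x,y)\triangleright_2 z+(x\succ_V y)\prec_V z=x\triangleleft_1 f_2(y,z)+x\succ_V(y\prec_V z)$.
   Context: The base field is $\mathbf{k}=\mathbb{C}$; all vector spaces and (bi)linear maps are over $\mathbf{k}$. A dendriform algebra is a vector space $D$ with bilinear operations $\succ,\prec:D\times D\to D$ such that for all $x,y,z\in D$: $(x\succ y+x\prec y)\succ z=x\succ(y\succ z)$; $(x\prec y)\prec z=x\prec(y\succ z+y\prec z)$; $(x\succ y)\prec z=x\succ(y\prec z)$. An extending datum of $D$ through a vector space $V$ is a system of twelve bilinear maps $\Omega(D,V)=(\triangleright_1,\triangleright_2,\triangleleft_1,\triangleleft_2,\rightharpoonup_1,\rightharpoonup_2,\leftharpoonup_1,\leftharpoonup_2,f_1,f_2,\succ_V,\prec_V)$ with $\triangleright_i:D\times V\to V$, $\triangleleft_i:V\times D\to V$, $\rightharpoonup_i:V\times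 D\to D$, $\leftharpoonup_i:D\times V\to D$, $f_i:V\times V\to D$ ($i=1,2$) and $\succ_V,\prec_V:V\times V\to V$. No identities are imposed on these maps. Given such a datum, define on the vector space $D\times V$, for $a,b\in D$, $x,y\in V$, $$(a,x)\succeq(b,y):=(a\succ b+a\leftharpoonup_1 y+x\rightharpoonup_1 b+f_1(x,y),\ a\triangleright_1 y+x\triangleleft_1 b+x\succ_V y),$$ $$(a,x)\preceq(b,y):=(a\prec b+a\leftharpoonup_2 y+x\rightharpoonup_2 b+f_2(x,y),\ a\triangleright_2 y+x\triangleleft_2 b+x\prec_V y).$$ $D\natural V=(D\times V,\succeq,\preceq)$ is called the unified product of $D$ and $\Omega(D,V)$ when it is a dendriform algebra. Conventions: $\star:=\succ+\prec$, $\triangleright:=\triangleright_1+\triangleright_2$, $\triangleleft:=\triangleleft_1+\triangleleft_2$, $\rightharpoonup:=\rightharpoonup_1+\rightharpoonup_2$, $\leftharpoonup:=\leftharpoonup_1+\leftharpoonup_2$, $f:=f_1+f_2$, $\star_V:=\succ_V+\prec_V$. $(V,\triangleright_1,\triangleright_2,\triangleleft_1,\triangleleft_2)$ is a $D$ bimodule if for all $a,b\in D$, $x\in V$: left module: $(a\star b)\triangleright_1x=a\triangleright_1(b\triangleright_1x)$, $(a\prec b)\triangleright_2x=a\triangleright_2(b\triangleright x)$, $(a\succ b)\triangleright_2x=a\triangleright_1(b\triangleright_2x)$; right module: $(x\triangleleft a)\triangleleft_1b=x\triangleleft_1(a\succ b)$, $(x\triangleleft_2a)\triangleleft_2b=x\triangleleft_2(a\star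 b)$, $(x\triangleleft_1a)\triangleleft_2b=x\triangleleft_1(a\prec b)$; compatibility: $(a\triangleright x)\triangleleft_1b=a\triangleright_1(x\triangleleft_1b)$, $(a\triangleright_2x)\triangleleft_2b=a\triangleright_2(x\triangleleft b)$, $(a\triangleright_1x)\triangleleft_2b=a\triangleright_1(x\triangleleft_2b)$. *)

(* Defs.v *)
From HB Require Import structures.
From mathcomp Require Import all_boot all_algebra.
From mathcomp Require Export reals complex.

Set Implicit Arguments.
Unset Strict Implicit.
Unset Printing Implicit Defensive.

Import GRing.Theory.
Local Open Scope ring_scope.

Definition is_dendriform (K : fieldType) (A : lmodType K)
    (succ prec : A -> A -> A) : Prop :=
  [/\ (forall y, linear (succ^~ y)) /\ (forall x, linear (succ x)),
      (forall y, linear (prec^~ y)) /\ (forall x, linear (prec x)),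
      forall x y z, succ (succ x y + prec x y) z = succ x (succ y z),
      forall x y z, prec (prec x y) z = prec x (succ y z + prec y z)
    & forall x y z, prec (succ x y) z = succ x (prec y z)].

HB.mixin Record Lmodule_isDendriform (K : fieldType) A of GRing.Lmodule K A := {
  dsucc : A -> A -> A;
  dprec : A -> A -> A;
  dendriformP : is_dendriform dsucc dprec
}.

#[short(type="dendriformType")]
HB.structure Definition Dendriform (K : fieldType) :=
  {A of GRing.Lmodule K A & Lmodule_isDendriform K A}.

Reserved Notation "a ≻ b" (at level 45, no associativity).
Reserved Notation "a ≺ b" (at level 45, no associativity).
Reserved Notation "a ⋆ b" (at level 45, no associativity).
Reserved Notation "a ▷₁ x" (at level 45, no associativity).
Reserved Notation "a ▷₂ x" (at level 45, no associativity).
Reserved Notation "a ▷ x" (at level 45, no associativity).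
Reserved Notation "x ◁₁ a" (at level 45, no associativity).
Reserved Notation "x ◁₂ a" (at level 45, no associativity).
Reserved Notation "x ◁ a" (at level 45, no associativity).
Reserved Notation "x ⇀₁ a" (at level 45, no associativity).
Reserved Notation "x ⇀₂ a" (at level 45, no associativity).
Reserved Notation "x ⇀ a" (at level 45, no associativity).
Reserved Notation "a ↼₁ x" (at level 45, no associativity).
Reserved Notation "a ↼₂ x" (at level 45, no associativity).
Reserved Notation "a ↼ x" (at level 45, no associativity).
Reserved Notation "x ≻V y" (at level 45, no associativity).
Reserved Notation "x ≺V y" (at level 45, no associativity).
Reserved Notation "x ⋆V y" (at level 45, no associativity).

Local Notation "a ≻ b" := (dsucc a b).
Local Notation "a ≺ b" := (dprec a b).
Local Notation "a ⋆ b" := (a ≻ b + a ≺ b).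

Section Bimodule.
Variables (K : fieldType) (D : dendriformType K) (V : lmodType K).
Variables (lact1 lact2 : {bilinear D -> V -> V}).
Variables (ract1 ract2 : {bilinear V -> D -> V}).

Local Notation "a ▷₁ x" := (lact1 a x).
Local Notation "a ▷₂ x" := (lact2 a x).
Local Notation "a ▷ x" := (a ▷₁ x + a ▷₂ x).
Local Notation "x ◁₁ a" := (ract1 x a).
Local Notation "x ◁₂ a" := (ract2 x a).
Local Notation "x ◁ a" := (x ◁₁ a + x ◁₂ a).

Definition dendriform_left_module : Prop := forall (a b : D) (x : V),
  [/\ (a ⋆ b) ▷₁ x = a ▷₁ (b ▷₁ x),
      (a ≺ b) ▷₂ x = a ▷₂ (b ▷ x)
    & (a ≻ b) ▷₂ x = a ▷₁ (b ▷₂ x)].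

Definition dendriform_right_module : Prop := forall (a b : D) (x : V),
  [/\ (x ◁ a) ◁₁ b = x ◁₁ (a ≻ b),
      (x ◁₂ a) ◁₂ b = x ◁₂ (a ⋆ b)
    & (x ◁₁ a) ◁₂ b = x ◁₁ (a ≺ b)].

Definition dendriform_module_compat : Prop := forall (a b : D) (x : V),
  [/\ (a ▷ x) ◁₁ b = a ▷₁ (x ◁₁ b),
      (a ▷₂ x) ◁₂ b = a ▷₂ (x ◁ b)
    & (a ▷₁ x) ◁₂ b = a ▷₁ (x ◁₂ b)].

Definition dendriform_bimodule : Prop :=
  [/\ dendriform_left_module, dendriform_right_module
    & dendriform_module_compat].

End Bimodule.

Record extending_datum (K : fieldType) (D : dendriformType K)
    (V : lmodType K) := ExtendingDatum {
  triR1 : {bilinear D -> V -> V};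
  triR2 : {bilinear D -> V -> V};
  triL1 : {bilinear V -> D -> V};
  triL2 : {bilinear V -> D -> V};
  harpR1 : {bilinear V -> D -> D};
  harpR2 : {bilinear V -> D -> D};
  harpL1 : {bilinear D -> V -> D};
  harpL2 : {bilinear D -> V -> D};
  cocyc1 : {bilinear V -> V -> D};
  cocyc2 : {bilinear V -> V -> D};
  succV : {bilinear V -> V -> V};
  precV : {bilinear V -> V -> V}
}.

Section UnifiedProduct.
Variables (K : fieldType) (D : dendriformType K) (V : lmodType K).
Variable Omega : extending_datum D V.

Local Notation "a ▷₁ x" := (triR1 Omega a x).
Local Notation "a ▷₂ x" := (triR2 Omega a x).
Local Notation "a ▷ x" := (a ▷₁ x + a ▷₂ x).
Local Notation "x ◁₁ a" := (triL1 Omega x a).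
Local Notation "x ◁₂ a" := (triL2 Omega x a).
Local Notation "x ◁ a" := (x ◁₁ a + x ◁₂ a).
Local Notation "x ⇀₁ a" := (harpR1 Omega x a).
Local Notation "x ⇀₂ a" := (harpR2 Omega x a).
Local Notation "x ⇀ a" := (x ⇀₁ a + x ⇀₂ a).
Local Notation "a ↼₁ x" := (harpL1 Omega a x).
Local Notation "a ↼₂ x" := (harpL2 Omega a x).
Local Notation "a ↼ x" := (a ↼₁ x + a ↼₂ x).
Local Notation f1 x y := (cocyc1 Omega x y).
Local Notation f2 x y := (cocyc2 Omega x y).
Local Notation f x y := (f1 x y + f2 x y).
Local Notation "x ≻V y" := (succV Omega x y).
Local Notation "x ≺V y" := (precV Omega x y).
Local Notation "x ⋆V y" := (x ≻V y + x ≺V y).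

Definition unified_succ (p q : D * V) : D * V :=
  let: (a, x) := p in let: (b, y) := q in
  (a ≻ b + a ↼₁ y + x ⇀₁ b + f1 x y, a ▷₁ y + x ◁₁ b + x ≻V y).

Definition unified_prec (p q : D * V) : D * V :=
  let: (a, x) := p in let: (b, y) := q in
  (a ≺ b + a ↼₂ y + x ⇀₂ b + f2 x y, a ▷₂ y + x ◁₂ b + x ≺V y).

Definition is_unified_product : Prop := is_dendriform unified_succ unified_prec.

Definition cond_D1 : Prop :=
  dendriform_bimodule (triR1 Omega) (triR2 Omega) (triL1 Omega) (triL2 Omega).

Definition cond_D2 : Prop := forall (a b : D) (x : V),
  [/\ (a ⋆ b) ↼₁ x = a ≻ (b ↼₁ x) + a ↼₁ (b ▷₁ x),
      (a ≺ b) ↼₂ x = a ≺ (b ↼ x) + a ↼₂ (b ▷ x)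
    & (a ≻ b) ↼₂ x = a ≻ (b ↼₂ x) + a ↼₁ (b ▷₂ x)].

Definition cond_D3 : Prop := forall (a b : D) (x : V),
  [/\ (x ⇀ a) ≻ b + (x ◁ a) ⇀₁ b = x ⇀₁ (a ≻ b),
      (x ⇀₂ a) ≺ b + (x ◁₂ a) ⇀₂ b = x ⇀₂ (a ⋆ b)
    & (x ⇀₁ a) ≺ b + (x ◁₁ a) ⇀₂ b = x ⇀₁ (a ≺ b)].

Definition cond_D4 : Prop := forall (a b : D) (x : V),
  [/\ (a ↼ x) ≻ b + (a ▷ x) ⇀₁ b = a ≻ (x ⇀₁ b) + a ↼₁ (x ◁₁ b),
      (a ↼₂ x) ≺ b + (a ▷₂ x) ⇀₂ b = a ≺ (x ⇀ b) + a ↼₂ (x ◁ b)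
    & (a ↼₁ x) ≺ b + (a ▷₁ x) ⇀₂ b = a ≻ (x ⇀₂ b) + a ↼₁ (x ◁₂ b)].

Definition cond_D5 : Prop := forall (a : D) (x y : V),
  [/\ (f x y) ≻ a + (x ⋆V y) ⇀₁ a = x ⇀₁ (y ⇀₁ a) + f1 x (y ◁₁ a),
      (f2 x y) ≺ a + (x ≺V y) ⇀₂ a = x ⇀₂ (y ⇀ a) + f2 x (y ◁ a)
    & (f1 x y) ≺ a + (x ≻V y) ⇀₂ a = x ⇀₁ (y ⇀₂ a) + f1 x (y ◁₂ a)].

Definition cond_D6 : Prop := forall (a : D) (x y : V),
  [/\ (x ⋆V y) ◁₁ a = x ◁₁ (y ⇀₁ a) + x ≻V (y ◁₁ a),
      (x ≺V y) ◁₂ a = x ◁₂ (y ⇀ a) + x ≺V (y ◁ a)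
    & (x ≻V y) ◁₂ a = x ◁₁ (y ⇀₂ a) + x ≻V (y ◁₂ a)].

Definition cond_D7 : Prop := forall (a : D) (x y : V),
  [/\ (a ↼ x) ↼₁ y + f1 (a ▷ x) y = a ≻ (f1 x y) + a ↼₁ (x ≻V y),
      (a ↼₂ x) ↼₂ y + f2 (a ▷₂ x) y = a ≺ (f x y) + a ↼₂ (x ⋆V y)
    & (a ↼₁ x) ↼₂ y + f2 (a ▷₁ x) y = a ≻ (f2 x y) + a ↼₁ (x ≺V y)].

Definition cond_D8 : Prop := forall (a : D) (x y : V),
  [/\ (a ↼ x) ▷₁ y + (a ▷ x) ≻V y = a ▷₁ (x ≻V y),
      (a ↼₂ x) ▷₂ y + (a ▷₂ x) ≺V y = a ▷₂ (x ⋆V y)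
    & (a ↼₁ x) ▷₂ y + (a ▷₁ x) ≺V y = a ▷₁ (x ≺V y)].

Definition cond_D9 : Prop := forall (a : D) (x y : V),
  [/\ (x ⇀ a) ↼₁ y + f1 (x ◁ a) y = x ⇀₁ (a ↼₁ y) + f1 x (a ▷₁ y),
      (x ⇀₂ a) ↼₂ y + f2 (x ◁₂ a) y = x ⇀₂ (a ↼ y) + f2 x (a ▷ y)
    & (x ⇀₁ a) ↼₂ y + f2 (x ◁₁ a) y = x ⇀₁ (a ↼₂ y) + f1 x (a ▷₂ y)].

Definition cond_D10 : Prop := forall (a : D) (x y : V),
  [/\ (x ⇀ a) ▷₁ y + (x ◁ a) ≻V y = x ◁₁ (a ↼₁ y) + x ≻V (a ▷₁ y),
      (x ⇀₂ a) ▷₂ y + (x ◁₂ a) ≺V y = x ◁₂ (a ↼ y) + x ≺V (a ▷ y)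
    & (x ⇀₁ a) ▷₂ y + (x ◁₁ a) ≺V y = x ◁₁ (a ↼₂ y) + x ≻V (a ▷₂ y)].

Definition cond_D11 : Prop := forall (x y z : V),
  [/\ (f x y) ↼₁ z + f1 (x ⋆V y) z = x ⇀₁ (f1 y z) + f1 x (y ≻V z),
      (f2 x y) ↼₂ z + f2 (x ≺V y) z = x ⇀₂ (f y z) + f2 x (y ⋆V z)
    & (f1 x y) ↼₂ z + f2 (x ≻V y) z = x ⇀₁ (f2 y z) + f1 x (y ≺V z)].

Definition cond_D12 : Prop := forall (x y z : V),
  [/\ (f x y) ▷₁ z + (x ⋆V y) ≻V z = x ◁₁ (f1 y z) + x ≻V (y ≻V z),
      (f2 x y) ▷₂ z + (x ≺V y) ≺V z = x ◁₂ (f y z) + x ≺V (y ⋆V z)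
    & (f1 x y) ▷₂ z + (x ≻V y) ≺V z = x ◁₁ (f2 y z) + x ≻V (y ≺V z)].

End UnifiedProduct.

(* Main.v *)
From HB Require Import structures.
Require Import Defs.
From mathcomp Require Import all_boot all_algebra.

Set Implicit Arguments.
Unset Strict Implicit.
Unset Printing Implicit Defensive.

Import GRing.Theory.
Local Open Scope ring_scope.

(** Each dendriform axiom is trilinear: both of its sides are additive in each
    of the three arguments.  Every element of D × V is the sum of an element of
    D and an element of V, so the axioms hold on D × V as soon as they hold on
    the eight kinds of triples whose entries are pure, that is, lie in D or in
    V (lemma dendriform_at_pure).

    On a pure triple most terms of the unified product vanish, and an axiom
    becomes one identity in D and one in V.  A triple from D × D × D gives back
    the axioms of D.  The other kinds give
<<
      triple   D-component   V-component
      DDV      cond_D2       left module part of cond_D1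
      VDD      cond_D3       right module part of cond_D1
      DVD      cond_D4       compatibility part of cond_D1
      VVD      cond_D5       cond_D6
      DVV      cond_D7       cond_D8
      VDV      cond_D9       cond_D10
      VVV      cond_D11      cond_D12
>>
    and the lemmas at_DDV, ..., at_VVV record this table.  Bilinearity of the
    two products, which is also part of being a dendriform algebra, holds for
    every extending datum. *)

(** * Additivity of the dendriform axioms *)

Section DendriformAt.
Variables (K : fieldType) (A : lmodType K).

(** Fixing the triple makes it possible to let the axioms vary one argument at
    a time. *)
Definition dendriform_at (succ prec : A -> A -> A) (p q r : A) : Prop :=
  [/\ succ (succ p q + prec p q) r = succ p (succ q r),
      prec (prec p q) r = prec p (succ q r + prec q r)
    & prec (succ p q) r = succ p (prec q r)].

Variables succ prec : {bilinear A -> A -> A}.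

Lemma is_dendriform_bilinear :
  is_dendriform succ prec <-> forall p q r, dendriform_at succ prec p q r.
Proof.
split=> [[_ _ H1 H2 H3] p q r | H]; first by split.
split; try by [move=> p q r; case: (H p q r)].
- by split=> p k u v; [exact: linearPl | exact: linearPr].
- by split=> p k u v; [exact: linearPl | exact: linearPr].
Qed.

Lemma dendriform_at_addl p p' q r :
  dendriform_at succ prec p q r -> dendriform_at succ prec p' q r ->
  dendriform_at succ prec (p + p') q r.
Proof.
move=> [H1 H2 H3] [H1' H2' H3'].
split; rewrite !(linearDl _ _ p p').
- by rewrite addrACA linearDl H1 H1'.
- by rewrite linearDl H2 H2'.
- by rewrite linearDl H3 H3'.
Qed.

Lemma dendriform_at_addm p q q' r :
  dendriform_at succ prec p q r -> dendriform_at succ prec p q' r ->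
  dendriform_at succ prec p (q + q') r.
Proof.
move=> [H1 H2 H3] [H1' H2' H3'].
split; rewrite !(linearDl _ _ q q') !(linearDr _ _ q q').
- by rewrite addrACA linearDl H1 H1' linearDr.
- by rewrite linearDl H2 H2' -linearDr addrACA.
- by rewrite linearDl H3 H3' linearDr.
Qed.

Lemma dendriform_at_addr p q r r' :
  dendriform_at succ prec p q r -> dendriform_at succ prec p q r' ->
  dendriform_at succ prec p q (r + r').
Proof.
move=> [H1 H2 H3] [H1' H2' H3'].
split; rewrite !(linearDr _ _ r r').
- by rewrite H1 H1' linearDr.
- by rewrite H2 H2' -linearDr addrACA.
- by rewrite H3 H3' linearDr.
Qed.

End DendriformAt.

(** * The unified product as a pair of bilinear operations *)

Section DendriformBilinear.
Variables (K : fieldType) (D : dendriformType K).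

Lemma dsucc_bilinear : bilinear_for *:%R *:%R (@dsucc K D).
Proof. by case: (@dendriformP K D) => [[Hl Hr]] _ _ _ _; split. Qed.

Lemma dprec_bilinear : bilinear_for *:%R *:%R (@dprec K D).
Proof. by case: (@dendriformP K D) => _ [Hl Hr] _ _ _; split. Qed.

HB.instance Definition _ :=
  bilinear_isBilinear.Build K D D D *:%R *:%R (@dsucc K D) dsucc_bilinear.
HB.instance Definition _ :=
  bilinear_isBilinear.Build K D D D *:%R *:%R (@dprec K D) dprec_bilinear.

End DendriformBilinear.

Section UnifiedProduct.
Variables (K : fieldType) (D : dendriformType K) (V : lmodType K).
Variable Omega : extending_datum D V.

Local Notation inD a := ((a, 0) : D * V).
Local Notation inV x := ((0, x) : D * V).
Local Notation usucc := (unified_succ Omega).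
Local Notation uprec := (unified_prec Omega).
Local Notation unified_at := (dendriform_at usucc uprec).

(** Used repeatedly, this regroups the sums of bilinear terms that make up each
    component of the product. *)
Lemma scale_addACA (W : lmodType K) (k : K) (u v u' v' : W) :
  k *: (u + v) + (u' + v') = (k *: u + u') + (k *: v + v').
Proof. by rewrite scalerDr addrACA. Qed.

Lemma unified_succ_bilinear : bilinear_for *:%R *:%R usucc.
Proof.
split=> -[c z] k [a x] [b y];
  by congr pair; rewrite /= ?(linearPl, linearPr) /= !scale_addACA.
Qed.

Lemma unified_prec_bilinear : bilinear_for *:%R *:%R uprec.
Proof.
split=> -[c z] k [a x] [b y];
  by congr pair; rewrite /= ?(linearPl, linearPr) /= !scale_addACA.
Qed.

HB.instance Definition _ := bilinear_isBilinear.Build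
  K (D * V)%type (D * V)%type (D * V)%type *:%R *:%R usucc unified_succ_bilinear.
HB.instance Definition _ := bilinear_isBilinear.Build
  K (D * V)%type (D * V)%type (D * V)%type *:%R *:%R uprec unified_prec_bilinear.

(** * Reduction to pure triples *)

Lemma pair_split (p : D * V) : p = inD p.1 + inV p.2.
Proof. by case: p => a x; congr pair; rewrite /= ?addr0 ?add0r. Qed.

Lemma dendriform_at_pure :
  (forall a b c, unified_at (inD a) (inD b) (inD c)) ->
  (forall a b x, unified_at (inD a) (inD b) (inV x)) ->
  (forall a b x, unified_at (inV x) (inD a) (inD b)) ->
  (forall a b x, unified_at (inD a) (inV x) (inD b)) ->
  (forall a x y, unified_at (inV x) (inV y) (inD a)) ->
  (forall a x y, unified_at (inD a) (inV x) (inV y)) ->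
  (forall a x y, unified_at (inV x) (inD a) (inV y)) ->
  (forall x y z, unified_at (inV x) (inV y) (inV z)) ->
  forall p q r, unified_at p q r.
Proof.
move=> ? ? ? ? ? ? ? ? p q r.
rewrite (pair_split p) (pair_split q) (pair_split r).
by apply: dendriform_at_addl; apply: dendriform_at_addm;
   apply: dendriform_at_addr.
Qed.

(** * Evaluation on pure triples *)

(** Removes the terms of the unified product that vanish because one entry of
    a pure element is zero. *)
Let pure0 := (linear0l, linear0r, addr0, add0r).

Lemma at_DDD a b c : unified_at (inD a) (inD b) (inD c).
Proof.
have [_ _ H1 H2 H3] := @dendriformP K D.
by split; congr pair; rewrite /= !pure0.
Qed.

(** The proofs of at_DDV, ..., at_VVV differ only in the triple: splitting the
    three dendriform axioms into their two components and removing the zero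
    terms leaves exactly the six identities on the right. *)
Ltac read_triple H := case: H; do 3!(case; rewrite !pure0 => ? ?); by split.

Ltac build_triple HD HV :=
  case: HD HV => ? ? ? [? ? ?]; by split; congr pair; rewrite /= !pure0.

Lemma at_DDV :
  (forall a b x, unified_at (inD a) (inD b) (inV x)) <->
  cond_D2 Omega /\
  dendriform_left_module (triR1 Omega) (triR2 Omega).
Proof.
split=> [H | [HD HV] a b x].
  by split=> a b x; read_triple (H a b x).
by build_triple (HD a b x) (HV a b x).
Qed.

Lemma at_VDD :
  (forall a b x, unified_at (inV x) (inD a) (inD b)) <->
  cond_D3 Omega /\
  dendriform_right_module (triL1 Omega) (triL2 Omega).
Proof.
split=> [H | [HD HV] a b x].
  by split=> a b x; read_triple (H a b x).
by build_triple (HD a b x) (HV a b x).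
Qed.

Lemma at_DVD :
  (forall a b x, unified_at (inD a) (inV x) (inD b)) <->
  cond_D4 Omega /\
  dendriform_module_compat
    (triR1 Omega) (triR2 Omega) (triL1 Omega) (triL2 Omega).
Proof.
split=> [H | [HD HV] a b x].
  by split=> a b x; read_triple (H a b x).
by build_triple (HD a b x) (HV a b x).
Qed.

Lemma at_VVD :
  (forall a x y, unified_at (inV x) (inV y) (inD a)) <->
  cond_D5 Omega /\ cond_D6 Omega.
Proof.
split=> [H | [HD HV] a x y].
  by split=> a x y; read_triple (H a x y).
by build_triple (HD a x y) (HV a x y).
Qed.

Lemma at_DVV :
  (forall a x y, unified_at (inD a) (inV x) (inV y)) <->
  cond_D7 Omega /\ cond_D8 Omega.
Proof.
split=> [H | [HD HV] a x y].
  by split=> a x y; read_triple (H a x y).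
by build_triple (HD a x y) (HV a x y).
Qed.

Lemma at_VDV :
  (forall a x y, unified_at (inV x) (inD a) (inV y)) <->
  cond_D9 Omega /\ cond_D10 Omega.
Proof.
split=> [H | [HD HV] a x y].
  by split=> a x y; read_triple (H a x y).
by build_triple (HD a x y) (HV a x y).
Qed.

Lemma at_VVV :
  (forall x y z, unified_at (inV x) (inV y) (inV z)) <->
  cond_D11 Omega /\ cond_D12 Omega.
Proof.
split=> [H | [HD HV] x y z].
  by split=> x y z; read_triple (H x y z).
by build_triple (HD x y z) (HV x y z).
Qed.

Lemma unified_product_iff :
  is_unified_product Omega <->
  (cond_D1 Omega /\ cond_D2 Omega /\ cond_D3 Omega /\ cond_D4 Omega /\
   cond_D5 Omega /\ cond_D6 Omega /\ cond_D7 Omega /\ cond_D8 Omega /\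
   cond_D9 Omega /\ cond_D10 Omega /\ cond_D11 Omega /\ cond_D12 Omega).
Proof.
rewrite /is_unified_product is_dendriform_bilinear.
split=> [H | [[Hl Hr Hc] [? [? [? [? [? [? [? [? [? [? ?]]]]]]]]]]]].
  have [? ?] := at_DDV.1 (fun a b x => H _ _ _).
  have [? ?] := at_VDD.1 (fun a b x => H _ _ _).
  have [? ?] := at_DVD.1 (fun a b x => H _ _ _).
  have [? ?] := at_VVD.1 (fun a x y => H _ _ _).
  have [? ?] := at_DVV.1 (fun a x y => H _ _ _).
  have [? ?] := at_VDV.1 (fun a x y => H _ _ _).
  have [? ?] := at_VVV.1 (fun x y z => H _ _ _).
  by split; first split.
apply: dendriform_at_pure at_DDD _ _ _ _ _ _ _.
- exact: at_DDV.2.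
- exact: at_VDD.2.
- exact: at_DVD.2.
- exact: at_VVD.2.
- exact: at_DVV.2.
- exact: at_VDV.2.
- exact: at_VVV.2.
Qed.

End UnifiedProduct.

Theorem theorem3p5 (R : realType) (D : dendriformType R[i])
    (V : lmodType R[i]) (Omega : extending_datum D V) :
  is_unified_product Omega <->
  (cond_D1 Omega /\ cond_D2 Omega /\ cond_D3 Omega /\ cond_D4 Omega /\
   cond_D5 Omega /\ cond_D6 Omega /\ cond_D7 Omega /\ cond_D8 Omega /\
   cond_D9 Omega /\ cond_D10 Omega /\ cond_D11 Omega /\ cond_D12 Omega).
Proof. exact: unified_product_iff. Qed.
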